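(* For every dimension $d$, integers $t\ge 2$, $k\ge 1$ and every convex polytope $P$ in $\mathbb{R}^d$ there exists an integer $m=m(t,k,P)$ with the following property: the (unordered) $t$-tuples of every finite point set $S\subset\mathbb{R}^d$ can be $k$-colored such that every homothet of $P$ that contains at least $m$ points of $S$ contains a $t$-tuple of points of $S$ of each of the $k$ colors.
   Context: A homothet of $P$ is a set of the form $\lambda P+v$ with $\lambda>0$ and $v\in\mathbb{R}^d$ (scaling and translation, no rotation). A $t$-tuple of points of $S$ is a $t$-element subset of $S$; a region contains it if it contains all its points. *)

(* Defs.v *)
From HB Require Import structures.
From mathcomp Require Import all_boot all_order all_algebra.
From mathcomp Require Import finmap.
From mathcomp Require Import reals.
Set Implicit Arguments. Unset Strict Implicit. Unset Printing Implicit Defensive.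
Import Order.TTheory GRing.Theory Num.Theory.
Local Open Scope ring_scope.

Definition conv_hull (R : realType) (d : nat) (V : seq 'rV[R]_d) : 'rV[R]_d -> Prop :=
  fun x => exists w : 'I_(size V) -> R,
    (forall i, 0 <= w i) /\ \sum_(i < size V) w i = 1 /\
    x = \sum_(i < size V) w i *: V`_i.

Definition convex_polytope (R : realType) (d : nat) (P : 'rV[R]_d -> Prop) : Prop :=
  exists V : seq 'rV[R]_d, V != [::] /\ forall x, P x <-> conv_hull V x.

Definition homothet (R : realType) (d : nat) (P : 'rV[R]_d -> Prop)
  (lam : R) (v : 'rV[R]_d) : 'rV[R]_d -> Prop :=
  fun x => exists p, P p /\ x = lam *: p + v.

(* Main.v *)
(** A finitely generated cone is polyhedral, so there are finitely many linear
    functionals [a_1, ..., a_N] such that every homothet of the polytope is of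
    the form [{x | forall j, b_j <= a_j x}].  Enumerate [S] and give a pair
    [x, y], with [x] enumerated first, the sign pattern
    [j |-> (a_j x <= a_j y)].  Pairs of a given pattern form a strict partial
    order, and a homothet containing [x] and [y] contains every point between
    them in that order.  Color a tuple [T] with first point [x] and last point
    [y] by the length modulo [k] of the longest chain from [x] to [y] in the
    order of the pattern of [x, y].  By an Erdos-Szekeres argument, a homothet
    with many points contains a long chain of one pattern; replace it by a
    longest chain with the same endpoints.  Its initial segments are again
    longest chains, so they realize all lengths, hence all colors. *)
Require Import Defs.
From HB Require Import structures.
From mathcomp Require Import all_boot all_order all_algebra.
From mathcomp Require Import finmap.
From mathcomp Require Import reals.
From mathcomp Require Import lra.
Set Implicit Arguments. Unset Strict Implicit. Unset Printing Implicit Defensive.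
Import Order.TTheory GRing.Theory Num.Theory.
Local Open Scope ring_scope.

(** * Finitely generated cones are polyhedral *)

Section PolyhedralCone.
Variables (R : realFieldType) (n : nat).
Implicit Types (x v : 'rV[R]_n) (a b : 'cV[R]_n).

Definition pairing x a : R := (x *m a) 0 0.

Lemma pairingDl x v a : pairing (x + v) a = pairing x a + pairing v a.
Proof. by rewrite /pairing mulmxDl mxE. Qed.

Lemma pairingZl (w : R) x a : pairing (w *: x) a = w * pairing x a.
Proof. by rewrite /pairing -scalemxAl mxE. Qed.

Lemma pairingBr x a b : pairing x (a - b) = pairing x a - pairing x b.
Proof. by rewrite /pairing mulmxBr !mxE. Qed.

Lemma pairingZr (w : R) x a : pairing x (w *: a) = w * pairing x a.
Proof. by rewrite /pairing -scalemxAr mxE. Qed.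

Definition in_cone (A : seq 'cV[R]_n) x := all (fun a => 0 <= pairing x a) A.

(** Peels off one coefficient at a time, so that adding a generator amounts to eliminating a single
    quantifier. *)
Fixpoint conic_hull (V : seq 'rV[R]_n) x : Prop :=
  if V is v :: V' then exists2 w : R, 0 <= w & conic_hull V' (x - w *: v)
  else x = 0.

(** Selects the coefficient [w] in the elimination below; either list may be empty. *)
Lemma exists_between (l u : seq R) :
  {in l & u, forall x y : R, x <= y} ->
  exists w, {in l, forall x : R, x <= w} /\ {in u, forall y, w <= y}.
Proof.
elim: l => [|x l IHl] lu.
  elim: u {lu} => [|y u [w [_ wu]]]; first by exists 0.
  exists (Num.min w y); split=> // z; rewrite inE ge_min.
  by case/predU1P=> [->|/wu ->]; rewrite ?lexx ?orbT.
have [|w [lw wu]] := IHl; first by move=> y z yl; apply: lu; rewrite inE yl orbT.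
exists (Num.max w x); split=> z.
  rewrite inE le_max.
  by case/predU1P=> [->|/lw ->]; rewrite ?lexx ?orbT.
by move=> zu; rewrite ge_max wu // lu ?mem_head.
Qed.

(* Fourier-Motzkin elimination of [w] from [in_cone A (x - w *: v)], [0 <= w]. *)
Lemma cone_add_ray (A : seq 'cV[R]_n) v :
  exists B, forall x,
    in_cone B x <-> exists2 w : R, 0 <= w & in_cone A (x - w *: v).
Proof.
pose Ap := [seq a <- A | 0 < pairing v a].
pose An := [seq a <- A | pairing v a < 0].
pose A0 := [seq a <- A | 0 <= pairing v a].
(* [comb a b] vanishes on [v] and, for [a] in [Ap] and [b] in [An], is a nonnegative combination of
   both. *)
pose comb a b := pairing v a *: b - pairing v b *: a.
have pB x w a : pairing (x - w *: v) a = pairing x a - w * pairing v a.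
  by rewrite pairingDl -scaleNr pairingZl mulNr.
exists (A0 ++ [seq comb a b | a <- Ap, b <- An]) => x.
rewrite /in_cone all_cat; split.
  case/andP=> /allP h0 /allP hc.
  (* Each functional of [An] bounds [w] from below, each of [Ap] from above; the lower bound 0
     accounts for [0 <= w]. *)
  have [|w [lw wu]] := @exists_between
    (0 :: [seq pairing x b / pairing v b | b <- An])
    [seq pairing x a / pairing v a | a <- Ap].
    move=> p q; rewrite inE => pl /mapP[a]; rewrite mem_filter => /andP[va aA] ->.
    case/predU1P: pl => [->|/mapP[b]].
      by rewrite divr_ge0 ?(ltW va) // h0 // mem_filter aA ltW.
    rewrite mem_filter => /andP[vb bA] ->.
    have : 0 <= pairing x (comb a b).
      by apply/hc/allpairs_f; rewrite mem_filter ?va ?vb.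
    rewrite pairingBr !pairingZr => h.
    rewrite ler_ndivrMr // mulrAC ler_pdivrMr //; lra.
  exists w; first by apply: lw; rewrite mem_head.
  apply/allP=> a aA; rewrite pB subr_ge0.
  have [va|va|va] := ltgtP (pairing v a) 0.
  - rewrite -ler_ndivrMr //; apply: lw; rewrite inE; apply/orP; right.
    by apply: map_f; rewrite mem_filter va.
  - rewrite -ler_pdivlMr //; apply: wu.
    by apply: map_f; rewrite mem_filter va.
  - by rewrite va mulr0 h0 // mem_filter va lexx.
case=> w w0 /allP h; apply/andP; split; apply/allP => a.
  rewrite mem_filter => /andP[va aA]; move: (h a aA); rewrite pB subr_ge0.
  by apply: le_trans; apply: mulr_ge0.
case/allpairsP=> -[b c] /= []; rewrite !mem_filter => /andP[vb bA] /andP[vc cA] ->.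
rewrite pairingBr !pairingZr.
move: (h b bA) (h c cA); rewrite !pB => hb hc.
have := mulr_ge0 (ltW vb) hc.
have := mulr_le0_ge0 (ltW vc) hb.
lra.
Qed.

(** Without generators the cone is zero, cut out by plus and minus each coordinate; every further
    generator adds a ray. *)
Lemma conic_hull_polyhedral (V : seq 'rV[R]_n) :
  exists A, forall x, in_cone A x <-> conic_hull V x.
Proof.
elim: V => [|v V [A hA]] /=.
  exists (codom (fun i => delta_mx i 0) ++ codom (fun i => - delta_mx i 0)) => x.
  have pE i : pairing x (delta_mx i 0) = x 0 i by rewrite /pairing -colE mxE.
  split=> [|->]; last by apply/allP=> a _; rewrite /pairing mul0mx mxE.
  rewrite /in_cone all_cat => /andP[/allP hp /allP hn].
  apply/rowP=> i; rewrite mxE; apply/eqP; rewrite eq_le -pE.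
  rewrite (hp _ (codom_f (fun i => delta_mx i 0) i)). rewrite andbT -oppr_ge0.
  have := hn _ (codom_f (fun i => - delta_mx i 0) i).
  by rewrite /pairing mulmxN mxE.
have [B hB] := cone_add_ray A v.
exists B => x; rewrite hB.
by split=> -[w w0 /hA hw]; exists w.
Qed.

Lemma conic_hullP (V : seq 'rV[R]_n) x :
  conic_hull V x <-> exists w : 'I_(size V) -> R,
    (forall i, 0 <= w i) /\ x = \sum_i w i *: V`_i.
Proof.
elim: V x => [|v V IHV] x /=.
  split=> [->|[w [_ ->]]]; last by rewrite big_ord0.
  by exists (fun=> 0); split=> //; rewrite big_ord0.
split=> [[w0 w0_ge0 /IHV [w [w_ge0 xE]]]|[w [w_ge0 ->]]].
  exists (fun i => if unlift ord0 i is Some j then w j else w0); split.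
    by move=> i; case: unliftP.
  rewrite big_ord_recl unlift_none /=.
  under eq_bigr => i _ do rewrite liftK.
  by rewrite -xE addrC subrK.
exists (w ord0) => //; apply/IHV; exists (fun i => w (lift ord0 i)); split=> //.
by rewrite big_ord_recl /= addrC addKr.
Qed.

End PolyhedralCone.

(** * Homothets as intersections of half-spaces with fixed normals *)

Lemma homothet_halfspaces (R : realType) (d : nat) (P : 'rV[R]_d -> Prop) :
  convex_polytope P ->
  exists A : seq 'cV[R]_d, forall lam v, 0 < lam ->
    exists b : 'I_(size A) -> R, forall x,
      homothet P lam v x <-> [forall j, b j <= pairing x A`_j].
Proof.
move=> [V [_ PV]].
(* Homogenization: [x] lies in the homothet iff [x - v] extended by [lam] lies in the cone over the
   points of [V] extended by 1. This cone does not depend on [lam] or [v]. *)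
pose lift1 (s : R) (x : 'rV[R]_d) : 'rV[R]_(d + 1) := row_mx x s%:M.
have [A hA] := conic_hull_polyhedral (map (lift1 1) V).
exists (map usubmx A) => lam v lam0.
exists (fun j => pairing v (usubmx A`_j) - lam * (dsubmx A`_j) 0 0) => x.
have homE : homothet P lam v x <-> conic_hull (map (lift1 1) V) (lift1 lam (x - v)).
  have sumE (w : nat -> R) : \sum_(i < size (map (lift1 1) V)) w i *: (map (lift1 1) V)`_i
     = lift1 (\sum_(i < size V) w i) (\sum_(i < size V) w i *: V`_i).
    rewrite size_map; apply/rowP=> j; rewrite summxE mxE.
    under eq_bigr => i _ do rewrite (nth_map 0) // mxE mxE.
    case: splitP => j' _; rewrite ?summxE.
      by apply: eq_bigr => i _; rewrite mxE.
    by rewrite ord1 !mxE eqxx !mulr1n -mulr_suml mulr1.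
  (* Weights on all of [nat] serve both [V] and its image under [map], whose index types differ. *)
  have extend (m : nat) (w : 'I_m -> R) :
      exists w' : nat -> R, forall i : 'I_m, w i = w' i.
    exists (fun i => if insub i is Some j then w j else 0) => i.
    by rewrite valK.
  rewrite conic_hullP; split.
    move=> [p [/PV [w [w_ge0 [w1 pE]]] ->]].
    have [w' ww'] := extend _ w.
    have sz := size_map (lift1 1) V.
    exists (fun i => lam * w' i); split.
      move=> i; rewrite mulr_ge0 ?(ltW lam0) //.
      by have := w_ge0 (cast_ord sz i); rewrite ww'.
    rewrite (sumE (fun i => lam * w' i)) -mulr_sumr.
    rewrite -(eq_bigr _ (fun i _ => ww' i)) w1 mulr1 addrK pE scaler_sumr; congr lift1.
    by apply: eq_bigr => i _; rewrite scalerA ww'.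
  move=> [w [w_ge0]]; have [w' ww'] := extend _ w.
  under eq_bigr => i _ do rewrite ww'.
  rewrite sumE => /eq_row_mx [xE lamE].
  have {}lamE : lam = \sum_(i < size V) w' i.
    by move/matrixP/(_ 0 0): lamE; rewrite !mxE.
  exists (lam^-1 *: (x - v)); split; last first.
    by rewrite scalerA divff ?gt_eqF // scale1r subrK.
  apply/PV; exists (fun i => lam^-1 * w' i); split.
    have sz := size_map (lift1 1) V.
    move=> i; rewrite mulr_ge0 ?invr_ge0 ?(ltW lam0) //.
    by have := w_ge0 (cast_ord (esym sz) i); rewrite ww'.
  rewrite -mulr_sumr -lamE mulVf ?gt_eqF //; split=> //.
  by rewrite xE scaler_sumr; apply: eq_bigr => i _; rewrite scalerA.
rewrite homE -hA.
have pE a : (0 <= pairing (lift1 lam (x - v)) a) =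
    (pairing v (usubmx a) - lam * (dsubmx a) 0 0 <= pairing x (usubmx a)).
  rewrite -[a in LHS]vsubmxK /pairing mul_row_col mulmxBl mul_scalar_mx !mxE.
  by rewrite -[LHS]subr_ge0 -[RHS]subr_ge0; congr (0 <= _); lra.
split.
  move/allP=> h; apply/forallP=> j.
  have jA : (j < size A)%N by rewrite -[size A](size_map usubmx).
  by rewrite (nth_map 0) // -pE h // mem_nth.
move=> /forallP h; apply/allP=> a aA; rewrite pE.
have jA : (index a A < size (map usubmx A))%N by rewrite size_map index_mem.
by have := h (Ordinal jA); rewrite /= (nth_map 0) ?index_mem // nth_index.
Qed.

(** * Longest chains in a strict order *)

Section LongestChain.
Variables (X : finType) (e : rel X).
Hypotheses (e_irr : irreflexive e) (e_tr : transitive e).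

Definition has_chain (x y : X) (n : nat) :=
  [exists s : n.-tuple X, path e x s && (last x s == y)].

(** Lengths count steps, not points. As [e] is a strict order, chains do not repeat points and the
    bound [#|X|] excludes none; with no chain the value is 0. *)
Definition longest_chain (x y : X) : nat :=
  \max_(n < #|X| | has_chain x y n) n.

Lemma has_chainP x y n :
  reflect (exists s, [/\ path e x s, last x s = y & size s = n]) (has_chain x y n).
Proof.
apply: (iffP existsP) => [[s /andP[es /eqP ls]]|[s [es ls /eqP sn]]].
  by exists s; rewrite size_tuple.
by exists (Tuple sn); rewrite /= es ls eqxx.
Qed.

Lemma size_chain_ltn x s : path e x s -> (size s < #|X|)%N.
Proof.
move=> es; have /card_uniqP xsE : uniq (x :: s) by apply: (sorted_uniq e_tr e_irr).
by rewrite -[(size s).+1]xsE max_card.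
Qed.

Lemma size_le_longest_chain x s :
  path e x s -> (size s <= longest_chain x (last x s))%N.
Proof.
move=> es; have sX := size_chain_ltn es.
apply: (@leq_bigmax_cond _ _ (fun n : 'I__ => n : nat) (Ordinal sX)).
by apply/has_chainP; exists s.
Qed.

Lemma longest_chain_witness x s0 : path e x s0 ->
  exists s, [/\ path e x s, last x s = last x s0
                & size s = longest_chain x (last x s0)].
Proof.
move=> es0; apply/has_chainP.
have sX := size_chain_ltn es0.
rewrite /longest_chain (bigop.bigmax_eq_arg (Ordinal sX)).
  by case: arg_maxnP => //; apply/has_chainP; exists s0.
by apply/has_chainP; exists s0.
Qed.

(** A longer chain to the end of [s1], continued by [s2], would beat the maximum. *)
Lemma longest_chain_prefix x s1 s2 : path e x (s1 ++ s2) ->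
  size (s1 ++ s2) = longest_chain x (last x (s1 ++ s2)) ->
  longest_chain x (last x s1) = size s1.
Proof.
rewrite cat_path => /andP[e1 e2] max_s.
apply/eqP; rewrite eqn_leq size_le_longest_chain // andbT.
have [s [es ls <-]] := longest_chain_witness e1.
have /size_le_longest_chain : path e x (s ++ s2) by rewrite cat_path es ls.
by rewrite last_cat ls -last_cat -max_s !size_cat leq_add2r.
Qed.

End LongestChain.

(** * The orders given by patterns, and the coloring that they define *)

Section PatternOrder.
Variables (X C : finType) (sig : X -> X -> C).
Hypothesis sig_tr : forall x y z, sig x y = sig y z -> sig x z = sig x y.

(** Any two distinct points are comparable for exactly one pattern, in the direction of the
    enumeration. *)
Definition prec (p : C) (x y : X) :=
  (enum_rank x < enum_rank y)%N && (sig x y == p).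

Lemma prec_irr p : irreflexive (prec p).
Proof. by move=> x; rewrite /prec ltnn. Qed.

Lemma prec_tr p : transitive (prec p).
Proof.
move=> y x z /andP[xy /eqP sxy] /andP[yz /eqP syz].
by rewrite /prec (ltn_trans xy yz) (@sig_tr x y z) ?sxy ?syz /=.
Qed.

(* Erdos-Szekeres: sending [x] to the lengths, one for each pattern, of the
   longest chains of [A] starting at [x] is injective. *)
Lemma exists_long_chain (L : nat) (A : {set X}) : (L.+1 ^ #|C| < #|A|)%N ->
  exists p x s, [/\ path (prec p) x s, {subset x :: s <= A} & size s = L.+1].
Proof.
move=> cardA.
pose H p x n := [exists s : n.-tuple X,
  path (prec p) x s && all (fun z => z \in A) (x :: s)].
have [/existsP[[p x] /existsP[s /andP[ps /allP sA]]]|noH] :=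
  boolP [exists px : C * X, H px.1 px.2 L.+1].
  by exists p, x, s; rewrite size_tuple.
pose h p x := \max_(n < L.+1 | H p x n) (n : nat).
have hL p x : (h p x < L.+1)%N by rewrite ltnS; apply/bigmax_leqP => n _; rewrite -ltnS.
pose g x : {ffun C -> 'I_L.+1} := [ffun p => Ordinal (hL p x)].
have h_lt x y : x \in A -> y \in A -> (enum_rank x < enum_rank y)%N ->
    (h (sig x y) y < h (sig x y) x)%N.
  move=> xA yA xy; set p := sig x y.
  (* Prepending [x] to a chain of pattern [p] from [y] gains one step. *)
  have Hstep n : H p y n -> H p x n.+1.
    case/existsP=> s /andP[ps sA]; apply/existsP; exists [tuple of y :: s].
    by rewrite /= xA ps /prec xy eqxx; move: sA => /= ->.
  have : H p y (h p y).
    have H0 : H p y (@ord0 L) by apply/existsP; exists [tuple]; rewrite /= yA.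
    rewrite /h (bigop.bigmax_eq_arg ord0) //.
    by case: arg_maxnP.
  move/Hstep => Hx.
  (* Since [A] has no chain of [L.+1] steps, the extended chain stays in the range of the maximum
     defining [h]. *)
  have hyL : ((h p y).+1 < L.+1)%N.
    rewrite ltn_neqAle hL andbT; apply: contra noH => /eqP hy.
    by apply/existsP; exists (p, x); rewrite -[X in H _ _ X]hy.
  exact: (@leq_bigmax_cond _ _ (fun n : 'I_L.+1 => n : nat) (Ordinal hyL)).
have g_inj : {in A &, injective g}.
  move=> x y xA yA /ffunP gxy.
  have hE p : h p x = h p y by have := gxy p; rewrite !ffunE => -[].
  apply/enum_rank_inj/val_inj/eqP; rewrite /=.
  case: ltngtP => // /h_lt lt; [have := lt xA yA|have := lt yA xA];
    by rewrite hE ltnn.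
move: cardA; rewrite -(card_in_imset g_inj) ltnNge.
by rewrite (leq_trans (max_card _)) // card_ffun card_ord.
Qed.

Definition is_extent (T : {set X}) (p : X * X) :=
  [&& p.1 \in T, p.2 \in T
    & [forall z in T, (enum_rank p.1 <= enum_rank z <= enum_rank p.2)%N]].

(** The color before reduction modulo [k]; only the empty set gets the default 0 for lack of an
    extent. *)
Definition chain_color (T : {set X}) : nat :=
  if [pick p | is_extent T p] is Some p
  then longest_chain (prec (sig p.1 p.2)) p.1 p.2 else 0.

Lemma chain_colorE T x y : is_extent T (x, y) ->
  chain_color T = longest_chain (prec (sig x y)) x y.
Proof.
move=> /and3P[/= xT yT /forall_inP xy]; rewrite /chain_color.
case: pickP => [[x' y'] /and3P[/= x'T y'T /forall_inP xy']|/(_ (x, y))]; last first.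
  by rewrite /is_extent /= xT yT; move/forall_inP: xy => ->.
have -> : x' = x.
  apply/enum_rank_inj/val_inj/eqP; rewrite eqn_leq /=.
  by have /andP[-> _] := xy' x xT; have /andP[-> _] := xy x' x'T.
have -> // : y' = y.
apply/enum_rank_inj/val_inj/eqP; rewrite eqn_leq /=.
by have /andP[_ ->] := xy y' y'T; have /andP[_ ->] := xy' y yT.
Qed.

(** Cut a longest chain after [j] steps: the initial segment is again longest, and its two ends
    together with [t] of the [j.-1] points in between form the tuple. *)
Lemma tuple_of_chain_color (t L j : nat) (A : {set X}) :
    (forall x y z, x \in A -> z \in A -> sig x y = sig y z -> y \in A) ->
    (L.+1 ^ #|C| < #|A|)%N -> (t < j)%N -> (j <= L.+1)%N ->
  exists T : {set X}, [/\ T \subset A, #|T| = t.+2 & chain_color T = j].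
Proof.
move=> A_conv /exists_long_chain[p [x [s0 [ps0 s0A s0L]]]] tj jL.
have tr := @prec_tr p; have irr := @prec_irr p.
have [s [ps ls sz]] := longest_chain_witness irr tr ps0.
have sL : (L.+1 <= size s)%N.
  by rewrite sz -s0L; apply: size_le_longest_chain.
(* The chain [s] may leave the points of [s0], but its ends lie in [A], and a point in between has
   pattern [p] both from [x] and to the last point, so [A_conv] applies. *)
have sA : {subset x :: s <= A}.
  have xA : x \in A by apply: s0A; rewrite mem_head.
  have yA : last x s \in A by rewrite ls; apply/s0A/mem_last.
  move=> z /predU1P[-> //|zs].
  case/splitPr: zs ps yA {sL sz ls} => s1 s2.
  rewrite cat_path last_cat /= => /and3P[ps1 s1z zs2] yA.
  have xz : prec p x z.
    by apply: (allP (order_path_min tr _) z (_ : z \in rcons s1 z));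
      rewrite ?rcons_path ?ps1 // mem_rcons mem_head.
  have [lz|zy] : last z s2 = z \/ prec p z (last z s2).
    case: s2 zs2 {yA} => [|z' s2] zs2; [by left | right].
    by have /allP := order_path_min tr zs2; apply; rewrite /= mem_last.
    by rewrite lz in yA.
  apply: (A_conv x z (last z s2)) => //.
  by case/andP: xz => _ /eqP->; case/andP: zy => _ /eqP->.
have j0 : (0 < j)%N by apply: leq_ltn_trans tj.
have j_lt : (j.-1 < size s)%N by rewrite prednK // (leq_trans jL).
(* As [s] omits [x], its entry of index [j.-1] is reached after [j] steps. *)
pose w := nth x s j.-1; pose s1 := take j.-1 s.
have sE : s = rcons s1 w ++ drop j s.
  by rewrite cat_rcons /w /s1 -[X in drop X s](prednK j0) -drop_nth // cat_take_drop.
have size_s1 : size s1 = j.-1 by rewrite size_takel // ltnW.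
have ps1 : path (prec p) x (rcons s1 w) by move: ps; rewrite {1}sE cat_path => /andP[].
have wlen : longest_chain (prec p) x w = j.
  have := @longest_chain_prefix _ _ irr tr x (rcons s1 w) (drop j s).
  by rewrite -sE last_rcons size_rcons size_s1 prednK // sz ls; apply.
(* The [t] filler points lie between [x] and [w] in the enumeration, so they do not affect the
   color. *)
pose T := x :: rcons (take t s1) w.
have Tsub : subseq T (x :: rcons s1 w).
  by rewrite /T /= eqxx -!cats1 cat_subseq ?take_subseq.
have Tuniq : uniq T.
  by apply: subseq_uniq Tsub _; apply: (sorted_uniq tr irr).
have xw : prec p x w.
  by apply: (allP (order_path_min tr ps1)); rewrite mem_rcons mem_head.
exists [set z in T]; split.
- apply/subsetP=> z; rewrite inE => /(mem_subseq Tsub) zs.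
  by apply: sA; rewrite sE -cat_cons mem_cat zs.
- rewrite cardsE (card_uniqP Tuniq) /= size_rcons size_takel //.
  by rewrite size_s1 -ltnS prednK.
- have /andP[_ /eqP sxw] := xw.
  rewrite (@chain_colorE _ x w) ?sxw //.
  have xT : x \in T by apply: mem_head.
  have wT : w \in T by rewrite /T in_cons mem_rcons mem_head orbT.
  rewrite /is_extent !in_set xT wT /=.
  apply/forall_inP=> z; rewrite in_set => /(mem_subseq Tsub) zs.
  apply/andP; split.
    case/predU1P: zs => [-> //|zs].
    by have /andP[/ltnW] := allP (order_path_min tr ps1) z zs.
  move: zs; rewrite -rcons_cons mem_rcons => /predU1P[-> //|].
  (* [order_path_min] compares with the head only; reversing the chain puts [w] there. *)
  have : sorted (fun u v => prec p v u) (w :: rev (x :: s1)).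
    by rewrite -rev_rcons rev_sorted.
  move=> /order_path_min h zs; apply: ltnW.
  suff /andP[] : prec p z w by [].
  apply: (allP (h _)); last by rewrite mem_rev.
  by move=> a b c ba ac; apply: tr ba.
Qed.

End PatternOrder.

(** * The coloring of tuples and the bound on the number of points *)

Local Open Scope fset_scope.

Theorem theorem6 (R : realType) (d t k : nat) (P : 'rV[R]_d -> Prop) :
  (2 <= t)%N -> (1 <= k)%N -> convex_polytope P ->
  exists m : nat, forall S : {fset 'rV[R]_d},
    exists c : {fset 'rV[R]_d} -> 'I_k,
      forall (lam : R) (v : 'rV[R]_d), 0 < lam ->
        (exists U : {fset 'rV[R]_d},
            U `<=` S /\ (m <= #|` U|)%N /\ (forall x, x \in U -> homothet P lam v x)) ->
        forall i : 'I_k, exists T : {fset 'rV[R]_d},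
          T `<=` S /\ #|` T| = t /\ (forall x, x \in T -> homothet P lam v x) /\ c T = i.
Proof.
case: t => [|[|t]] // _ k0 /homothet_halfspaces[A hA].
(* Here [t] is the tuple size minus 2. For [i < k] the length [k * t.+1 + i] is [i] modulo [k],
   exceeds [t] and is at most [L.+1]. *)
pose L := (k * t.+1 + k)%N.
pose C : finType := {ffun 'I_(size A) -> bool}.
exists (L.+1 ^ #|C|).+1 => S.
pose sig (x y : S) : C := [ffun j : 'I_(size A) => pairing (val x) A`_j <= pairing (val y) A`_j].
(* For each functional, equal signs mean two weak increases or two strict decreases, and both
   compose. *)
have sig_tr x y z : sig x y = sig y z -> sig x z = sig x y.
  move=> sE; apply/ffunP => j; have := congr1 (fun f : C => f j) sE; rewrite !ffunE.
  case: lerP => [xy /esym yz|xy /esym/negbT]; first by rewrite (le_trans xy yz).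
  by rewrite -ltNge => yz; rewrite leNgt (lt_trans yz xy).
pose c (T : {fset 'rV[R]_d}) := chain_color sig [set x : S | val x \in T].
exists (fun T => Ordinal (ltn_pmod (c T) k0)) => lam v lam0 [U [US [mU UP]]] i.
have [b hb] := hA lam v lam0.
pose B := [set x : S | [forall j, b j <= pairing (val x) A`_j]].
(* Each functional is at least as large at [y] as at [x] or at [z], so the lower bounds [b] pass to
   [y]. *)
have B_conv x y z : x \in B -> z \in B -> sig x y = sig y z -> y \in B.
  rewrite !inE => /forallP xB /forallP zB sE; apply/forallP => j.
  have := congr1 (fun f : C => f j) sE; rewrite !ffunE.
  case: lerP => [xy _|xy /esym/negbT]; first exact: le_trans (xB j) xy.
  by rewrite -ltNge => /ltW; apply: le_trans.
have cardB : (L.+1 ^ #|C| < #|B|)%N.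
  apply: leq_trans mU _.
  have sub : U `<=` [fset val x | x in B].
    apply/fsubsetP=> x xU; have xS := fsubsetP US x xU.
    apply/imfsetP; exists [` xS] => //=.
    by rewrite inE; apply/hb/UP.
  apply: leq_trans (fsubset_leq_card sub) _.
  by rewrite card_imfset //=; [rewrite cardE | apply: val_inj].
have [||T [TB cardT cT]] := @tuple_of_chain_color _ _ _ sig_tr t L (k * t.+1 + i) B B_conv cardB.
- by apply: leq_trans (leq_addr _ _); rewrite leq_pmull.
- by rewrite /L leqW // leq_add2l ltnW.
exists [fset val x | x in T]; split; [|split; [|split]].
- by apply/fsubsetP=> x /imfsetP[y _ ->]; apply: valP.
- by rewrite card_imfset //=; [rewrite -cardE | apply: val_inj].
- move=> x /imfsetP[y /= yT ->]; apply/hb.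
  by have := subsetP TB y yT; rewrite inE.
apply: val_inj => /=; rewrite /c.
have -> : [set x : S | val x \in [fset val y | y in T]] = T.
  apply/setP=> x; rewrite inE; apply/imfsetP/idP => [[y /= yT /val_inj->] //|xT].
  by exists x.
by rewrite cT mulnC modnMDl modn_small.
Qed.
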